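(* Let $G_1,\dots,G_m$ be unweighted directed graphs with no vertices or edges in common, and let $v_i\in V(G_i)$ for each $i$. Let $K$ be the joined graph obtained from the disjoint union of the $G_i$ by adding a single new vertex $b$ with in-degree $0$ and out-degree $m$, with one edge from $b$ to $v_i$ for each $i$. Let $t_i$ denote the propagation time of randomized zero forcing on $G_i$ starting with the single blue vertex $v_i$. Then $$\operatorname{ept}_{\mathrm{rzf}}(K,b)\le \max_i \operatorname{ept}_{\mathrm{rzf}}(G_i,v_i)+\left(\frac{\sum_{i=1}^m \operatorname{Var}(t_i)}{2}\right)^{1/2}+O(r\,m^{1/2}),$$ where $r=\max_i r_i$ and $r_i$ is the in-degree of $v_i$ in $K$.
   Context: Directed graphs are finite, without loops or multiple edges. The constant implied by $O(\cdot)$ is absolute. The right-hand side is interpreted as $\infty$ if some $\operatorname{ept}_{\mathrm{rzf}}(G_i,v_i)=\infty$. Randomized zero forcing (RZF) on an unweighted directed graph $G$: start with blue set $B_0$. Given the blue set $B_t$, each white vertex $w\notin B_t$ independently becomes blue at round $t+1$ with probability equal to (number of in-neighbors of $w$ in $B_t$)/(indegree of $w$), and with probability $0$ if $w$ has indegree $0$; blue vertices stay blue forever. The propagation time is the random variable $\tau=\min\{t: B_t=V(G)\}$. $\operatorname{ept}_{\mathrm{rzf}}(G,v)$ is the expected value of the propagation time started from $B_0=\{v\}$ if it is possible to color all of $G$ blue from $\{v\}$, and $\infty$ otherwise. *)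

(* Defs.v *)
From HB Require Import structures.
From mathcomp Require Import all_boot all_order all_algebra.
From mathcomp Require Import all_classical all_reals all_analysis.
From mathcomp Require Import ring.

Set Implicit Arguments.
Unset Strict Implicit.
Unset Printing Implicit Defensive.

Import Order.TTheory GRing.Theory Num.Theory.

Local Open Scope classical_set_scope.
Local Open Scope ring_scope.

Record digraph := Digraph {
  vertex :> finType;
  arc : rel vertex;
  arc_irreflexive : irreflexive arc }.

Arguments arc {d} _ _.

Definition indegree (G : digraph) (w : G) : nat := #|[set u | arc u w]|%SET.

(* The quotient is 0 when [w] has indegree 0, since [0 / 0 = 0]. *)
Definition force_prob (R : realType) (G : digraph) (B : {set G}) (w : G) : R :=
  #|[set u in B | arc u w]|%SET%:R / (indegree w)%:R.

(* Probability that the blue set [B] becomes [B'] in one round: no blue vertex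
   is lost, and the white vertices change independently of each other. *)
Definition rzf_trans (R : realType) (G : digraph) (B B' : {set G}) : R :=
  (B \subset B')%:R *
  \prod_(w | w \notin B)
     (if w \in B' then force_prob R B w else 1 - force_prob R B w).

(* A realization, on some probability space, of randomized zero forcing on [G]
   started from [[set v]]. The law is given through the joint distribution of
   the blue sets: conditionally on the history up to round [t], the blue set at
   round [t.+1] is drawn according to [rzf_trans]. *)
Record rzf_process (R : realType) (G : digraph) (v : G) := RZFProcess {
  rzf_display : measure_display;
  rzf_space : measurableType rzf_display;
  rzf_prob : probability rzf_space R;
  blue : nat -> rzf_space -> {set G};
  measurable_blue :
    forall t (B : {set G}), measurable [set x | blue t x = B];
  blue0 : forall x, blue 0 x = [set v]%SET;
  blue_markov : forall t (B : nat -> {set G}),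
    rzf_prob [set x | forall i, (i <= t.+1)%N -> blue i x = B i] =
    (rzf_prob [set x | forall i, (i <= t)%N -> blue i x = B i]
     * (rzf_trans R (B t) (B t.+1))%:E)%E }.

Arguments blue {R G v} _ _ _.

(* Every [rzf_process R v] is inhabited. *)
Module RZFExistence.
Section Existence.
Variables (R : realType) (G : digraph) (v : G).
Local Notation trans := (@rzf_trans R G).
Local Notation sets := (enum {: {set G}}).

Lemma force_prob_ge0 (B : {set G}) w : 0 <= force_prob R B w.
Proof. by rewrite divr_ge0. Qed.

Lemma force_prob_le1 (B : {set G}) w : force_prob R B w <= 1.
Proof.
rewrite /force_prob; have [->|n0] := posnP (indegree w).
  by rewrite invr0 mulr0.
rewrite ler_pdivrMr ?ltr0n// mul1r ler_nat subset_leq_card//.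
by apply/fintype.subsetP => x; rewrite !inE => /andP[].
Qed.

Lemma rzf_trans_ge0 (B B' : {set G}) : 0 <= trans B B'.
Proof.
rewrite mulr_ge0// prodr_ge0// => w _; case: ifP => _.
  exact: force_prob_ge0.
by rewrite subr_ge0 force_prob_le1.
Qed.

Lemma rzf_trans_sum (B : {set G}) : \sum_B' trans B B' = 1.
Proof.
pose f w : R := if w \in B then 1 else force_prob R B w.
pose g w : R := if w \in B then 0 else 1 - force_prob R B w.
have := @bigA_distr R 0 1 *%R +%R G f g.
rewrite big1 => [|w _]; last by rewrite /f /g /=; case: ifP => _; rewrite ?addr0 // addrC subrK.
move=> /esym; under eq_bigl do rewrite /=.
move=> <-; apply: eq_bigr => A _; rewrite /rzf_trans.
rewrite [RHS](bigID (mem B)) /= [X in _ = _ * X]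
  (_ : _ = \prod_(w | w \notin B)
     (if w \in A then force_prob R B w else 1 - force_prob R B w)); last first.
  by apply: eq_bigr => w wB; rewrite /f /g (negbTE wB).
congr (_ * _); case: (boolP (B \subset A)) => BA.
  by rewrite big1// => w wB; rewrite /f (fintype.subsetP BA) ?wB.
move: BA => /fintype.subsetPn[w wB wA].
by rewrite (bigD1 w)//= (negbTE wA) /g wB mul0r.
Qed.

(* [U] uniform on [0, 1[ drives the chain by interval subdivision: a round from
   [B] picks the set whose subinterval, of length [rzf_trans R B _], contains the
   current number, which is then rescaled to [0, 1[. The event that the blue sets
   up to round [t] are [B 0, ..., B t] is an interval, with left end and length
   [lo B t]. *)
Definition cum (B : {set G}) n : R := \sum_(0 <= i < n) trans B (nth finset.set0 sets i).

Lemma cum_last B : cum B (size sets) = 1.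
Proof.
rewrite -(rzf_trans_sum B) /cum -(big_nth finset.set0 xpredT (trans B)) big_enum//.
Qed.

Lemma cumS B n : cum B n.+1 = cum B n + trans B (nth finset.set0 sets n).
Proof. by rewrite /cum big_nat_recr. Qed.

Lemma cum_homo B : {homo cum B : m n / (m <= n)%N >-> m <= n}.
Proof.
apply: homo_leq => // [? ? ?|n]; first exact: le_trans.
by rewrite cumS lerDl rzf_trans_ge0.
Qed.

Definition idx (A : {set G}) := index A sets.

Definition hit (B : {set G}) (u : R) (A : {set G}) :=
  (cum B (idx A) <= u) && (u < cum B (idx A).+1).

Lemma cum_idxS B A : cum B (idx A).+1 = cum B (idx A) + trans B A.
Proof. by rewrite cumS nth_index// mem_enum. Qed.

Lemma hit_ex B u : 0 <= u < 1 -> exists A, hit B u A.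
Proof.
case/andP=> u0 u1; have ex : exists k, u < cum B k by exists (size sets); rewrite cum_last.
have [k uk kmin] := @ex_minnP (fun k => u < cum B k) ex.
case: k uk kmin => [|k] uk kmin.
  by move: uk; rewrite /cum big_geq// ltNge u0.
have ck : cum B k <= u.
  by rewrite leNgt; apply/negP => /kmin; rewrite ltnn.
have ks : (k < size sets)%N.
  by apply: kmin; rewrite cum_last.
exists (nth finset.set0 sets k).
by rewrite /hit /idx index_uniq ?enum_uniq// ck uk.
Qed.

Lemma hit_uniq B u A A' : hit B u A -> hit B u A' -> A = A'.
Proof.
wlog : A A' / (idx A <= idx A')%N => [hw|].
  case: (leqP (idx A) (idx A')) => [|/ltnW]; first exact: hw.
  by move=> /hw h a b; symmetry; exact: h.
rewrite leq_eqVlt => /orP[/eqP e _ _|].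
  by rewrite -(nth_index finset.set0 (mem_enum _ A)) -/(idx A) e nth_index ?mem_enum.
move=> /cum_homo -/(_ B) h /andP[_ a] /andP[b _].
by have := lt_le_trans a (le_trans h b); rewrite ltxx.
Qed.

Definition step (s : {set G} * R) : {set G} * R :=
  let A := odflt s.1 [pick A | hit s.1 s.2 A] in
  (A, (s.2 - cum s.1 (idx A)) / trans s.1 A).

Lemma stepE B u A : 0 <= u < 1 -> ((step (B, u)).1 == A) = hit B u A.
Proof.
move=> u01; rewrite /step /=; case: pickP => [A' hA'|h] /=.
  by apply/eqP/idP => [<-//|]; exact: hit_uniq.
by have [A' /=] := hit_ex B u01; rewrite h.
Qed.

Definition st t u := iter t step ([set v]%SET, u).

Fixpoint lo (B : nat -> {set G}) t : R * R :=
  if t is t'.+1 then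
    let: (a, l) := lo B t' in
    (a + l * cum (B t') (idx (B t)), l * trans (B t') (B t))
  else (0, (B 0%N == [set v]%SET)%:R).

Lemma lo_ge0 B t : (0 <= (lo B t).1) /\ (0 <= (lo B t).2)
   /\ (lo B t).1 + (lo B t).2 <= 1.
Proof.
elim: t => [|t] /=.
  by split=> //; split => //; rewrite add0r; case: eqP.
case: (lo B t) => a l /= [a0 [l0 al]].
have c0 : 0 <= cum (B t) (idx (B t.+1)) by apply: sumr_ge0 => *; exact: rzf_trans_ge0.
have t0 := rzf_trans_ge0 (B t) (B t.+1).
have c1 : cum (B t) (idx (B t.+1)) + trans (B t) (B t.+1) <= 1.
  rewrite -cum_idxS -(cum_last (B t)); apply: cum_homo.
  by rewrite index_mem mem_enum.
split; first by rewrite addr_ge0// mulr_ge0.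
split; first by rewrite mulr_ge0.
apply: le_trans al; rewrite -addrA lerD2l -mulrDr -[leRHS]mulr1.
exact: ler_wpM2l.
Qed.

Lemma st_path B t u : 0 <= u < 1 ->
  ((forall i, (i <= t)%N -> (st i u).1 = B i) <->
   (lo B t).1 <= u < (lo B t).1 + (lo B t).2)
  /\ ((lo B t).1 <= u < (lo B t).1 + (lo B t).2 ->
     (st t u).2 = (u - (lo B t).1) / (lo B t).2).
Proof.
move=> u01; elim: t => [|t [IH1 IH2]].
  rewrite /= subr0 add0r; split; last first.
    by case: eqP => _ /=; rewrite ?divr1// => /andP[a b]; case/negP: (le_lt_trans a b); rewrite ltxx.
  split=> [/(_ 0%N isT) <-|].
    by rewrite /st /= eqxx.
  case: eqP => [B0 _ [|//] _|_ /andP[a b]]; first by rewrite B0.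
  by have := le_lt_trans a b; rewrite ltxx.
have [a0 [l0 al]] := lo_ge0 B t.
have key : (forall i, (i <= t)%N -> (st i u).1 = B i) ->
  (((st t.+1 u).1 = B t.+1) <-> (lo B t.+1).1 <= u < (lo B t.+1).1 + (lo B t.+1).2)
  /\ ((lo B t.+1).1 <= u < (lo B t.+1).1 + (lo B t.+1).2 ->
     (st t.+1 u).2 = (u - (lo B t.+1).1) / (lo B t.+1).2).
  move=> hi; have h1 := IH1.1 hi; have h2 := IH2 h1.
  have l1 : 0 < (lo B t).2 by case/andP: h1 => x /(le_lt_trans x); rewrite ltrDl.
  have ss : st t.+1 u = step (B t, (u - (lo B t).1) / (lo B t).2).
    by rewrite /st iterS -/(st t u) [st t u]surjective_pairing h2 hi.
  have ut01 : 0 <= (u - (lo B t).1) / (lo B t).2 < 1.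
    case/andP: h1 => x y.
    by rewrite divr_ge0 ?subr_ge0//= ltr_pdivrMr// mul1r ltrBlDl.
  have hE : hit (B t) ((u - (lo B t).1) / (lo B t).2) (B t.+1) =
       ((lo B t.+1).1 <= u < (lo B t.+1).1 + (lo B t.+1).2).
    rewrite /hit cum_idxS /=; case: (lo B t) l1 => a l /= l1.
    rewrite ler_pdivlMr// ltr_pdivrMr// lerBrDl ltrBlDl [_ * l]mulrC.
    by rewrite [_ * l]mulrC mulrDr addrA.
  rewrite ss -hE; split.
    by rewrite -(stepE _ _ ut01); split=> /eqP.
  move=> hh; have := hh; rewrite -(stepE _ _ ut01) => /eqP e.
  rewrite {1}/step /=.
  have -> : odflt (B t) [pick A | hit (B t) ((u - (lo B t).1) / (lo B t).2) A] = B t.+1.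
    exact: e.
  have [t0|t0] := eqVneq (trans (B t) (B t.+1)) 0.
    case: (lo B t) => a l /=; by rewrite t0 mulr0 invr0 !mulr0.
  case: (lo B t) l1 => a l /= l1; field.
  by rewrite t0 gt_eqF.
have back : (lo B t.+1).1 <= u < (lo B t.+1).1 + (lo B t.+1).2 ->
    forall i, (i <= t)%N -> (st i u).1 = B i.
  move=> /= h; apply/IH1; move: h.
  have c0 : 0 <= cum (B t) (idx (B t.+1)) by apply: sumr_ge0 => *; exact: rzf_trans_ge0.
  have c1 : cum (B t) (idx (B t.+1)) + trans (B t) (B t.+1) <= 1.
    rewrite -cum_idxS -(cum_last (B t)); apply: cum_homo.
    by rewrite index_mem mem_enum.
  case: (lo B t) l0 => a l /= l0 /andP[x y].
  apply/andP; split; first by apply: le_trans x; rewrite lerDl mulr_ge0.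
  apply: (lt_le_trans y); rewrite -addrA lerD2l -mulrDr -[leRHS]mulr1.
  exact: ler_wpM2l.
split; last by move=> h; exact: (key (back h)).2.
split.
  move=> h; have hi i : (i <= t)%N -> (st i u).1 = B i by move=> it; apply/h/leqW.
  by apply/(key hi).1; exact: h.
move=> h i; rewrite leq_eqVlt => /orP[/eqP ->|]; last exact: (back h).
exact/(key (back h)).1.
Qed.

Local Notation I01 := (`[(0:R), (1:R)[%classic : set (measurableTypeR R)).

Definition ex_blue t (u : R) : {set G} :=
  if 0 <= u < 1 then (st t u).1 else [set v]%SET.

Lemma ex_path B t : I01 `&` [set u | forall i, (i <= t)%N -> ex_blue i u = B i] =
  `[(lo B t).1, (lo B t).1 + (lo B t).2[%classic.
Proof.
have [a0 [l0 al]] := lo_ge0 B t.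
apply/seteqP; split => u; rewrite /= !in_itv/= /ex_blue.
  by move=> [u01]; rewrite u01 => /(st_path B t u01).1.
move=> h; have u01 : 0 <= u < 1.
  by case/andP: h => x y; rewrite (le_trans a0 x) (lt_le_trans y al).
by split=> //; rewrite u01; apply/(st_path B t u01).1.
Qed.

Lemma ex_measurable_path B t :
  measurable [set u : measurableTypeR R | forall i, (i <= t)%N -> ex_blue i u = B i].
Proof.
set E := (X in measurable X).
rewrite (_ : E = (I01 `&` E) `|`
  (~` I01 `&` [set u | forall i, (i <= t)%N -> B i = [set v]%SET])); last first.
  apply/seteqP; split => u.
    move=> Eu; have [u01|u01] := boolP (0 <= u < 1); [left|right] => /=.
      by rewrite in_itv.
    rewrite in_itv/=; split; first exact/negP.
    by move=> i /Eu; rewrite /ex_blue (negbTE u01).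
  case=> [[_ //]|[/= u01 h] i it].
  by rewrite h// /ex_blue; move: u01; rewrite in_itv/= => /negP/negbTE ->.
apply: measurableU; first by rewrite ex_path; exact: measurable_itv.
apply: measurableI; first by apply: measurableC; exact: measurable_itv.
have [h|h] := pselect (forall i, (i <= t)%N -> B i = [set v]%SET).
  by rewrite (_ : mkset _ = setT)//; apply/seteqP; split.
by rewrite (_ : mkset _ = classical_sets.set0)//; apply/seteqP; split.
Qed.

Lemma ex_measurable t (B : {set G}) :
  measurable [set u : measurableTypeR R | ex_blue t u = B].
Proof.
rewrite (_ : mkset _ = \bigcup_(f in [set f : {ffun 'I_t.+1 -> {set G}} | f ord_max = B])
  [set u | forall i, (i <= t)%N -> ex_blue i u = f (inord i)]); last first.
  apply/seteqP; split => u /=.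
    move=> <-; exists [ffun i : 'I_t.+1 => ex_blue i u] => /=; first by rewrite ffunE.
    by move=> i it; rewrite ffunE inordK.
  move=> [f <- ->//]; congr (f _); apply/val_inj => /=; by rewrite inordK.
apply: fin_bigcup_measurable; first exact: finite_finset.
by move=> f _; exact: ex_measurable_path.
Qed.

Local Notation U := (uniform_prob (@ltr01 R)).

Lemma U_itv (a b : R) : 0 <= a -> a <= b -> b <= 1 -> U `[a, b[%classic = (b - a)%:E.
Proof.
move=> a0 ab b1; rewrite /uniform_prob.
rewrite (eq_integral (fun=> 1%:E)); last first.
  move=> x; rewrite inE/= in_itv/= /uniform_pdf => /andP[x1 x2].
  by rewrite (le_trans a0 x1) (le_trans (ltW x2) b1) subr0 invr1.
rewrite integral_cst//= mul1e lebesgue_measure_itv/= lte_fin.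
by move: ab; rewrite le_eqVlt => /orP[/eqP ->|->]; rewrite ?ltxx ?subrr.
Qed.

Lemma U_restr (A : set (measurableTypeR R)) : measurable A -> U A = U (I01 `&` A).
Proof.
move=> mA; have mI : measurable I01 by exact: measurable_itv.
have U01 : U I01 = 1%E by rewrite U_itv ?subr0.
have UC : U (~` I01) = 0%E by rewrite probability_setC// [X in (1 - X)%E]U01 subee.
rewrite (measureDI U mA mI) setIC -[RHS]add0e; congr (_ + _)%E.
apply/eqP; rewrite eq_le measure_ge0 andbT -UC le_measure// ?inE//.
  exact: measurableD.
exact: measurableC.
Qed.

Lemma ex_markov t (B : nat -> {set G}) :
  U [set u | forall i, (i <= t.+1)%N -> ex_blue i u = B i] =
  (U [set u | forall i, (i <= t)%N -> ex_blue i u = B i] * (trans (B t) (B t.+1))%:E)%E.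
Proof.
rewrite U_restr; last exact: ex_measurable_path.
rewrite [in RHS]U_restr; last exact: ex_measurable_path.
rewrite !ex_path; have [a0 [l0 al]] := lo_ge0 B t.
have [a0' [l0' al']] := lo_ge0 B t.+1.
rewrite !U_itv ?lerDl// ![_ + _ - _]addrAC !subrr !add0r -EFinM; congr EFin.
by rewrite /=; case: (lo B t).
Qed.

Lemma ex_blue0 u : ex_blue 0 u = [set v]%SET.
Proof. by rewrite /ex_blue /st /=; case: ifP. Qed.

Lemma rzf_process_exists : inhabited (rzf_process R v).
Proof.
split; exact: (@RZFProcess R G v _ _ U ex_blue ex_measurable ex_blue0 ex_markov).
Qed.

End Existence.

End RZFExistence.

Section PropagationTime.
Context {R : realType} {G : digraph} {v : G}.
Variable X : rzf_process R v.

(* The least [t] with every vertex blue at round [t], and [+oo] (the infimum of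
   the empty set) if there is none. *)
Definition prop_time (x : rzf_space X) : \bar R :=
  ereal_inf [set t%:R%:E | t in [set t : nat | blue X t x = [set: G]%SET]].

Definition can_color_all : Prop :=
  exists t, (0 < rzf_prob X [set x | blue X t x = [set: G]%SET])%E.

Definition ept_rzf : \bar R :=
  if `[< can_color_all >] then (\int[rzf_prob X]_x prop_time x)%E else +oo%E.

(* [fine] only alters [prop_time] where it is infinite, which is a null event
   as soon as [can_color_all] holds. *)
Definition var_prop_time : \bar R :=
  variance (rzf_prob X) (fun x => fine (prop_time x)).

End PropagationTime.

Section Join.
Context {m : nat}.
Variables (G : 'I_m -> digraph) (v : forall i, G i).

(* [None] is the new vertex b; [Some (Tagged _ x)] is the vertex [x] of the
   [i]-th graph in the disjoint union. *)
Definition join_vertex : finType := option {i : 'I_m & G i}.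

Definition join_arc : rel join_vertex := fun x y =>
  match x, y with
  | Some x, Some y => (tag x == tag y) && arc (tagged x) (tagged_as x y)
  | None, Some y => tagged y == v (tag y)
  | _, None => false
  end.

Lemma join_arc_irreflexive : irreflexive join_arc.
Proof. by move=> [[i x]|] //=; rewrite tagged_asE arc_irreflexive andbF. Qed.

Definition join : digraph := Digraph join_arc_irreflexive.

Definition join_source : join := None.

Definition join_inj (i : 'I_m) (x : G i) : join := Some (Tagged G x).

End Join.

(* Main.v *)
Require Import Defs.
From mathcomp Require Import all_boot all_order all_algebra.
From mathcomp Require Import all_classical all_reals all_analysis.
From mathcomp Require Import measurable_realfun ring lra.

(* Writing [t_i] for the propagation time of [G_i], the vertex b first forces
   [v_i] after a geometric time [g_i] of mean [r_i], so the propagation time of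
   the join is the maximum of the independent variables [Z_i = g_i + t_i], whose
   means are at most [E t_i + r] and variances at most [Var t_i + r^2].

   For independent [Z_i] with means at most [mu] and variances summing to [S],
   [E max Z_i <= mu + sqrt (S / 2)] up to an additive constant. Let
   [p_i(x) = P(Z_i > mu + x)]. Since [1 - p >= exp (- p / (1 - p))], convexity of
   the exponential gives, for every [u > 0],
     [1 - prod_i (1 - p_i) <= 1 - u + u ln u + u sum_i p_i / (1 - p_i)].
   Take [u = x / A], for [x < A], and integrate: the first part contributes
   [A / 4], and the second at most [S / (2 A)] because
   [int_0^oo 2 x p_i(x) / (1 - p_i(x)) dx <= Var Z_i]. The choice
   [A = sqrt (2 S)] gives [sqrt (S / 2)]. Truncating the [Z_i] at a common round
   turns the integrals into finite sums and does not increase the variances. *)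
Import Order.TTheory GRing.Theory Num.Theory.
Local Open Scope ring_scope.

Set Implicit Arguments.
Unset Strict Implicit.
Unset Printing Implicit Defensive.

(** * Weighted sums of tail probabilities *)

Section TailSums.
Variable R : realType.
Implicit Types (a e f p : nat -> R).

Lemma sum_odd n : \sum_(i < n) (2 * i%:R + 1) = n%:R ^+ 2 :> R.
Proof.
elim: n => [|n IH]; first by rewrite big_ord0 expr0n.
by rewrite big_ord_recr /= IH -natr1; ring.
Qed.

(** By monotonicity [l * p l] is at most the sum of the first [l] terms, so adding [p l] raises the
    squared sum by at least [(2 l + 1) * p l ^ 2]. *)
Lemma sqr_sum_nonincr p l : (forall k, 0 <= p k) -> (forall k, p k.+1 <= p k) ->
  \sum_(k < l) (2 * k%:R + 1) * p k ^+ 2 <= (\sum_(k < l) p k) ^+ 2.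
Proof.
move=> p0 pS; elim: l => [|l IH]; first by rewrite !big_ord0 expr0n.
rewrite !big_ord_recr /=.
have h : l%:R * p l <= \sum_(k < l) p k.
  elim: {IH} l => [|l IH]; first by rewrite big_ord0 mul0r.
  rewrite big_ord_recr /= -natr1 mulrDl mul1r lerD//.
  by rewrite (le_trans _ IH)// ler_wpM2l.
have := ler_wpM2r (p0 l) h.
move: IH; set x := \sum_(k < l) _; set y := \sum_(k < l) _ => IH hy.
nra.
Qed.

(** A new term [f l] raises the left side by [2 s f l + f l ^ 2], with [s] the old sum. On the right
    every old weight grows by 2, which adds [q (2 s + f l)]. *)
Lemma sqr_sum_bounded f (q : R) l :
  (forall t, (t < l)%N -> 0 <= f t <= q) ->
  (\sum_(t < l) f t) ^+ 2 <= q * \sum_(t < l) (2 * (l%:R - t%:R) - 1) * f t.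
Proof.
elim: l => [|l IH] fq; first by rewrite !big_ord0 expr0n mulr0.
have {}IH := IH (fun t tl => fq t (ltnW tl)).
rewrite !big_ord_recr /=.
have -> : \sum_(i < l) (2 * (l.+1%:R - i%:R) - 1) * f i =
  \sum_(i < l) (2 * (l%:R - i%:R) - 1) * f i + 2 * \sum_(i < l) f i.
  rewrite mulr_sumr -big_split /=; apply: eq_bigr => i _.
  by rewrite -natr1; ring.
have /andP[fl0 flq] := fq l (ltnSn l).
have s0 : 0 <= \sum_(i < l) f i.
  by apply: sumr_ge0 => i _; case/andP: (fq i (ltnW (ltn_ord i))).
rewrite -natr1; nra.
Qed.

(** Discrete form of [int 2 x p / (1 - p) <= Var], for a threshold [N] at least the mean. Let [D]
    and [E] be the mean deficit below [N] and the mean excess over it. The variance is the sum of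
    the second moments of deficit and excess, minus [(D - E) ^ 2]; the former moment is at least
    [D ^ 2 / q] by [sqr_sum_bounded]. *)
Lemma sum_odds_tail e N l : (forall t, 0 <= e t <= 1) ->
  (forall t, e t.+1 <= e t) -> e N < 1 -> \sum_(t < N + l) e t <= N%:R ->
  \sum_(k < l) (2 * k%:R + 1) * (e (N + k)%N / (1 - e (N + k)%N)) <=
  \sum_(t < N + l) (2 * t%:R + 1) * e t - (\sum_(t < N + l) e t) ^+ 2.
Proof.
move=> e01 eS eN; rewrite !big_split_ord /=.
pose p k := e (N + k)%N; pose F t := 1 - e t; pose q := 1 - e N.
set E := \sum_(i < l) e _; set s := \sum_(i < N) e i => sN.
have q0 : 0 < q by rewrite subr_gt0.
have emono i j : (i <= j)%N -> e j <= e i by exact/(nonincreasing_seqP e).1.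
have q1 : q <= 1 by rewrite lerBlDr lerDl; case/andP: (e01 N).
have p0 k : 0 <= p k by case/andP: (e01 (N + k)%N).
have E0 : 0 <= E by apply: sumr_ge0 => k _; exact: (p0 k).
have -> : \sum_(i < N) (2 * i%:R + 1) * e i =
    N%:R ^+ 2 - \sum_(i < N) (2 * i%:R + 1) * F i.
  by rewrite -sum_odd -sumrB; apply: eq_bigr => i _; rewrite /F; ring.
have -> : \sum_(i < l) (2 * (N + i)%:R + 1) * e (N + i)%N =
    2 * N%:R * E + \sum_(i < l) (2 * i%:R + 1) * p i.
  rewrite mulr_sumr -big_split /=; apply: eq_bigr => i _.
  by rewrite natrD /p; ring.
have sE : s = N%:R - \sum_(i < N) F i.
  by rewrite sumrB /= sumr_const card_ord opprB addrC subrK.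
have := @sqr_sum_bounded F q N _.
have -> : \sum_(t < N) (2 * (N%:R - t%:R) - 1) * F t =
    2 * N%:R * (\sum_(t < N) F t) - \sum_(i < N) (2 * i%:R + 1) * F i.
  by rewrite mulr_sumr -sumrB; apply: eq_bigr => i _; ring.
have h t : (t < N)%N -> 0 <= F t <= q.
  move=> tN; rewrite subr_ge0 lerD2l lerN2 emono ?(ltnW tN)// andbT.
  by case/andP: (e01 t).
move=> /(_ h) {h}.
have := @sqr_sum_nonincr p l p0 _.
have pS k : p k.+1 <= p k by rewrite /p addnS.
move=> /(_ pS); rewrite -/E.
(* Uses [1 / (1 - p) = 1 + p / (1 - p) <= 1 + p / q]; the resulting [p ^ 2] terms are controlled by
   [E ^ 2]. *)
have : \sum_(k < l) (2 * k%:R + 1) * (p k / (1 - p k)) <=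
   \sum_(i < l) (2 * i%:R + 1) * p i + q^-1 * \sum_(k < l) (2 * k%:R + 1) * p k ^+ 2.
  rewrite mulr_sumr -big_split /=; apply: ler_sum => k _.
  have pk : p k <= e N by apply: emono; rewrite leq_addr.
  have -> : (2 * k%:R + 1) * p k + q^-1 * ((2 * k%:R + 1) * p k ^+ 2) =
    (2 * k%:R + 1) * (p k * (1 + p k / q)) by ring.
  apply: ler_wpM2l; first by rewrite addr_ge0// mulr_ge0.
  apply: ler_wpM2l => //.
  have qk : 0 < 1 - p k by rewrite subr_gt0 (le_lt_trans pk).
  have qq : q <= 1 - p k by rewrite lerD2l lerN2.
  rewrite -[leLHS]mul1r ler_pdivrMr// mulrDl mul1r.
  rewrite -[leLHS](subrK (p k)) lerD2l mulrAC ler_pdivlMr// .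
  by rewrite ler_wpM2l.
move: sN; rewrite sE.
move: (\sum_(k < l) _ * (_ / _)) => Q.
move: (\sum_(k < l) _ * _ ^+ 2) => P2.
move: (\sum_(k < l) _ * _) => P1.
move: (\sum_(k < N) _ * _) => L.
set D := \sum_(i < N) F i => sN hQ hP2 hL.
have ED : E <= D by lra.
rewrite -(ler_pM2l q0).
have {}hQ : q * Q <= q * P1 + P2.
  by rewrite -(ler_pM2l q0) mulrDr mulrA divff ?lt0r_neq0// mul1r in hQ.
(* It remains that [D ^ 2 - E ^ 2 - q (D - E) ^ 2] is nonnegative; it equals
   [2 E (D - E) + (1 - q) (D - E) ^ 2]. *)
have h1 : 0 <= E * (D - E) by rewrite mulr_ge0// subr_ge0.
have h2 : 0 <= (1 - q) * (D - E) ^+ 2 by rewrite mulr_ge0 ?sqr_ge0// subr_ge0.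
nra.
Qed.

End TailSums.

(** * Tangent bound for one minus a product *)

Section ProductBound.
Variable R : realType.

(** Factor by factor, [1 / (1 - p) = 1 + p / (1 - p) <= exp (p / (1 - p))]. *)
Lemma prodr_onem_ge_exp (I : finType) (p : I -> R) : (forall i, 0 <= p i < 1) ->
  expR (- \sum_i p i / (1 - p i)) <= \prod_i (1 - p i).
Proof.
move=> p01; rewrite -sumrN expR_sum; apply: ler_prod => i _.
have /andP[p0 p1] := p01 i; have q0 : 0 < 1 - p i by rewrite subr_gt0.
rewrite expR_ge0 /= expRN -[leRHS]invrK lef_pV2 ?posrE ?invr_gt0 ?expR_gt0//.
rewrite (le_trans _ (expR_ge1Dx _))// le_eqVlt; apply/orP; left; apply/eqP.
by field; rewrite gt_eqF.
Qed.

(** The ratio telescopes into factors [1 - 1 / j.+1 <= exp (- 1 / j.+1)]. *)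
Lemma ratio_le_exp (k A : nat) : (k <= A)%N -> (0 < k)%N ->
  k%:R / A%:R <= expR (- \sum_(k <= j < A) j.+1%:R^-1) :> R.
Proof.
move=> kA k0; elim: A kA => [|A IH].
  by rewrite leqn0 => /eqP k00; rewrite k00 in k0.
rewrite leq_eqVlt => /orP[/eqP <-|].
  by rewrite big_geq// oppr0 expR0 divff// pnatr_eq0 gtn_eqF.
rewrite ltnS => kA; rewrite big_nat_recr//= opprD expRD.
have A0 : (0 < A)%N by exact: leq_trans kA.
have -> : k%:R / A.+1%:R = k%:R / A%:R * (1 + - A.+1%:R^-1) :> R.
  rewrite -natr1; field; rewrite ?pnatr_eq0 ?gtn_eqF//=.
  by rewrite natr1 pnatr_eq0.
by rewrite ler_pM ?IH ?expR_ge1Dx ?divr_ge0// subr_ge0 invf_le1// ler1n.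
Qed.

(* The tangent to [exp (- x)] at [x = ln (A / k)], with the logarithm replaced
   by the harmonic sum that it dominates. *)
Definition tangent_gap (A k : nat) : R :=
  if (k < A)%N then 1 - k%:R / A%:R * (1 + \sum_(k <= j < A) j.+1%:R^-1) else 0.

(** With [N] the sum of the ratios and [H] the harmonic sum, the product is at least [exp (- H) *
    exp (H - N) >= k / A * (1 + H - N)]. Once [k >= A], the bound [1 - exp (- N) <= N] suffices. *)
Lemma onem_prod_le_tangent (I : finType) (p : I -> R) (A k : nat) :
  (0 < A)%N -> (forall i, 0 <= p i < 1) ->
  1 - \prod_i (1 - p i) <= tangent_gap A k + k%:R / A%:R * \sum_i p i / (1 - p i).
Proof.
move=> A0 p01; have := prodr_onem_ge_exp p01.
set N := \sum_i _ => hN.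
have N0 : 0 <= N.
  apply: sumr_ge0 => i _; have /andP[p0 p1] := p01 i.
  by rewrite divr_ge0// subr_ge0 ltW.
rewrite /tangent_gap; case: ltnP => kA; last first.
  rewrite add0r; have h1 : 1 - N <= \prod_i (1 - p i).
    by rewrite (le_trans _ hN)// expR_ge1Dx.
  rewrite lerBlDr -lerBlDl in h1; rewrite (le_trans h1)// .
  by rewrite ler_peMl// ler_pdivlMr ?ltr0n// mul1r ler_nat.
case: k kA => [|k] kA.
  rewrite !mul0r subr0 addr0 lerBlDr lerDl; apply: le_trans hN; exact: expR_ge0.
set H := \sum_(_ <= j < _) _.
have h : k.+1%:R / A%:R * (1 + H - N) <= \prod_i (1 - p i).
  apply: le_trans hN; have -> : expR (- N) = expR (- H) * expR (H - N).
    by rewrite -expRD; congr expR; ring.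
  have hk := @ratio_le_exp k.+1 A (ltnW kA) isT.
  have h2 := expR_ge1Dx (H - N).
  apply: (@le_trans _ _ (k.+1%:R / A%:R * expR (H - N))).
    by rewrite -[1 + H - N]addrA; apply: ler_wpM2l => //; rewrite divr_ge0.
  by rewrite ler_wpM2r ?expR_ge0.
move: h; rewrite mulrBr; lra.
Qed.

(** The previous bound for an empty family. *)
Lemma tangent_gap_ge0 (A k : nat) : (0 < A)%N -> 0 <= tangent_gap A k.
Proof.
move=> A0; have := @onem_prod_le_tangent 'I_0 (fun=> 0) A k A0.
by rewrite !big_ord0 subrr mulr0 addr0; apply => -[].
Qed.

(** Discrete counterpart of [int_0^1 (1 - u + u ln u) du = 1 / 4], scaled by [A]. *)
Lemma sum_tangent_gap (A : nat) : (0 < A)%N ->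
  \sum_(k < A) tangent_gap A k = (A%:R - 1) / 4 + 1.
Proof.
move=> A0; have An0 : A%:R != 0 :> R by rewrite pnatr_eq0 gtn_eqF.
apply: (mulfI An0).
have -> : A%:R * \sum_(k < A) tangent_gap A k =
   \sum_(k < A) (A%:R - k%:R * (1 + \sum_(k <= j < A) j.+1%:R^-1)).
  rewrite mulr_sumr; apply: eq_bigr => k _.
  by rewrite /tangent_gap ltn_ord; field.
(* After multiplication by [A], passing to [A.+1] changes summand [i] only by [1 - i / A.+1]. *)
move=> {A0 An0}; elim: A => [|A IH]; first by rewrite big_ord0 mul0r.
rewrite big_ord_recr /= big_nat1.
have -> : \sum_(i < A) (A.+1%:R - i%:R * (1 + \sum_(i <= j < A.+1) j.+1%:R^-1)) =
  \sum_(i < A) (A%:R - i%:R * (1 + \sum_(i <= j < A) j.+1%:R^-1)) +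
  \sum_(i < A) (1 - i%:R / A.+1%:R) :> R.
  rewrite -big_split /=; apply: eq_bigr => i _.
  by rewrite big_nat_recr ?(ltnW (ltn_ord i))//= -natr1; ring.
have s1 : \sum_(i < A) (1 - i%:R / A.+1%:R) = A%:R - (A%:R * (A%:R - 1) / 2) / A.+1%:R :> R.
  rewrite sumrB sumr_const card_ord -mulr_suml; congr (_ - _ / _).
  elim: (A) => [|n IHn]; first by rewrite big_ord0 !mul0r.
  by rewrite big_ord_recr /= IHn -natr1; field.
rewrite IH s1 -natr1; field.
by rewrite nat1r pnatr_eq0.
Qed.

Lemma sum_tangent_gap_le (A l : nat) : (0 < A)%N ->
  \sum_(k < l) tangent_gap A k <= (A%:R - 1) / 4 + 1.
Proof.
move=> A0; rewrite -(sum_tangent_gap A0).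
rewrite -(big_mkord predT (tangent_gap A)) -[leRHS](big_mkord predT (tangent_gap A)).
case: (leqP l A) => lA.
  rewrite [leRHS](big_cat_nat (leq0n l) lA)//= lerDl sumr_ge0// => *; exact: tangent_gap_ge0.
rewrite (big_cat_nat (leq0n A) (ltnW lA))//= [X in _ + X]big_nat_cond [X in _ + X]big1 ?addr0//.
by move=> k /andP[/andP[Ak _] _]; rewrite /tangent_gap ltnNge Ak.
Qed.

End ProductBound.

(** * Expected maximum of independent variables, and geometric delays *)

Section ExpectedMaximum.
Variable R : realType.
Implicit Types (e f : nat -> R).

(* For the tail [e t = P(T > t)] of an integer random variable [T], this is the
   variance of [min T n]. *)
Definition tail_var e n : R :=
  \sum_(t < n) (2 * t%:R + 1) * e t - (\sum_(t < n) e t) ^+ 2.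

(* The tail of [T] plus an independent number of trials until the first success,
   of probability [rho] each, where [f] is the tail of [T]. *)
Fixpoint delay (rho : R) f (t : nat) : R :=
  if t is t'.+1 then (1 - rho) * delay rho f t' + rho * f t' else 1.

Lemma sum_onem_prod_le (I : finType) (e : I -> nat -> R) (M S : R) n :
  (forall i t, 0 <= e i t <= 1) -> (forall i t, e i t.+1 <= e i t) ->
  0 <= M -> (forall i, \sum_(t < n) e i t <= M) ->
  0 <= S -> \sum_i tail_var (e i) n <= S ->
  \sum_(t < n) (1 - \prod_i (1 - e i t)) <= M + 2 + Num.sqrt (S / 2).
Proof.
move=> e01 eS M0 eM S0 eV.
(* An integer threshold above all the means, as [sum_odds_tail] requires; the rounding costs at most
   1. *)
pose N := (Num.trunc M).+1.
have MN : M < N%:R by exact: truncnS_gt.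
have NM : N%:R <= M + 1.
  by rewrite -natr1 lerD2r truncn_le.
pose s := Num.sqrt (2 * S).
have s0 : 0 <= s by exact: sqrtr_ge0.
have s2 : s ^+ 2 = 2 * S by rewrite sqr_sqrtr// mulr_ge0.
have sE : Num.sqrt (S / 2) = s / 2.
  have -> : S / 2 = (s / 2) ^+ 2 by rewrite expr_div_n s2; field.
  by rewrite sqrtr_sqr ger0_norm// divr_ge0.
(* A positive integer just above [sqrt (2 S)], the minimizer of [A / 4 + S / (2 A)]. *)
pose A := (Num.trunc s).+1.
have sA : s < A%:R by exact: truncnS_gt.
have As : A%:R - 1 <= s.
  by rewrite -natr1 addrK truncn_le.
have A0 : 0 < A%:R :> R by rewrite ltr0n.
have one_le t : 1 - \prod_i (1 - e i t) <= 1.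
  rewrite lerBlDr lerDl prodr_ge0// => i _.
  by rewrite subr_ge0; case/andP: (e01 i t).
have [nN|Nn] := leqP n N.
  apply: (@le_trans _ _ n%:R).
    apply: (@le_trans _ _ (\sum_(t < n) 1)); first exact: ler_sum.
    by rewrite sumr_const card_ord.
  have : n%:R <= N%:R :> R by rewrite ler_nat.
  by have := sqrtr_ge0 (S / 2); lra.
have [l nE] : exists l, n = (N + l.+1)%N.
  by exists (n - N.+1)%N; rewrite addnS -addSn subnKC.
subst n.
(* Otherwise the first [N] terms would all be 1, with sum [N > M]. *)
have eN i : e i N < 1.
  rewrite ltNge; apply/negP => e1.
  have := eM i; apply/negP; rewrite -ltNge.
  apply: (lt_le_trans MN); apply: (@le_trans _ _ (\sum_(t < N) e i t)).
    rewrite -[X in X%:R]card_ord -sumr_const; apply: ler_sum => t _.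
    by apply: (le_trans e1); apply: (nonincreasing_seqP (e i)).1 => //; exact: ltnW.
  rewrite big_split_ord /= lerDl sumr_ge0// => t _.
  by case/andP: (e01 i (N + t)%N).
have pe i k : 0 <= e i (N + k)%N < 1.
  case/andP: (e01 i (N + k)%N) => -> _ /=; apply: le_lt_trans (eN i).
  by apply: (nonincreasing_seqP (e i)).1 => //; rewrite leq_addr.
rewrite big_split_ord /=.
have h1 : \sum_(t < N) (1 - \prod_i (1 - e i t)) <= N%:R.
  apply: (@le_trans _ _ (\sum_(t < N) 1)); first exact: ler_sum.
  by rewrite sumr_const card_ord.
have h2 : \sum_(k < l.+1) (1 - \prod_i (1 - e i (N + k)%N)) <=
    \sum_(k < l.+1) tangent_gap R A k + (2 * A%:R)^-1 * S.
  apply: (@le_trans _ _ (\sum_(k < l.+1) (tangent_gap R A k +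
     k%:R / A%:R * \sum_i e i (N + k)%N / (1 - e i (N + k)%N)))).
    apply: ler_sum => k _; apply: onem_prod_le_tangent => // i; exact: pe.
  rewrite big_split /= lerD2l.
  apply: (@le_trans _ _ ((2 * A%:R)^-1 * \sum_i tail_var (e i) (N + l.+1))); last first.
    by apply: ler_wpM2l => //; rewrite invr_ge0 mulr_ge0.
  apply: (@le_trans _ _ ((2 * A%:R)^-1 * \sum_i \sum_(k < l.+1)
     (2 * k%:R + 1) * (e i (N + k)%N / (1 - e i (N + k)%N)))); last first.
    apply: ler_wpM2l; first by rewrite invr_ge0 mulr_ge0.
    apply: ler_sum => i _; apply: sum_odds_tail => //.
    exact: le_trans (eM i) (ltW MN).
  rewrite exchange_big /= mulr_sumr; apply: ler_sum => k _.
  rewrite -mulr_sumr mulrA; apply: ler_wpM2r.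
    apply: sumr_ge0 => i _; have /andP[p0 p1] := pe i k.
    by rewrite divr_ge0// subr_ge0 ltW.
  (* The odd weight [2 k + 1] over [2 A] dominates the slope [k / A] of the tangent bound. *)
  have -> : (2 * A%:R)^-1 * (2 * k%:R + 1) = (k%:R + 2^-1) / A%:R :> R.
    by field; rewrite gt_eqF.
  by apply: ler_wpM2r; rewrite ?invr_ge0// lerDl.
have h3 := @sum_tangent_gap_le R A l.+1 isT.
have h4 : (2 * A%:R)^-1 * S <= s / 4.
  rewrite mulrC ler_pdivrMr ?mulr_gt0//.
  have : s * s <= s * A%:R by rewrite ler_wpM2l// ltW.
  by rewrite -expr2 s2; lra.
rewrite sE; lra.
Qed.

(** Each step is a convex combination of the delayed tail with [f t], hence stays above
    [f t >= f t.+1] and decreases. *)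
Lemma delay_bounds (rho : R) f : 0 <= rho <= 1 -> (forall t, 0 <= f t <= 1) ->
  (forall t, f t.+1 <= f t) ->
  (forall t, f t <= delay rho f t <= 1) /\
  (forall t, delay rho f t.+1 <= delay rho f t).
Proof.
move=> /andP[rho0 rho1] f01 fS.
have h t : f t <= delay rho f t <= 1.
  elim: t => [|t /andP[IH1 IH2]] /=; first by case/andP: (f01 0%N) => _ ->/=.
  have := fS t; have /andP[] := f01 t; nra.
by split=> // t /=; have /andP[] := h t; nra.
Qed.

(** Condition on the first trial. With [d] the difference of the means, the law of total variance
    mixes the two variances and adds [rho (1 - rho) d ^ 2]; since [d <= r], the total is at most
    [v + (1 - rho ^ 2) r ^ 2]. *)
Lemma delay_moments (rho r v : R) f : 0 <= rho <= 1 -> 0 <= r -> rho * r = 1 ->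
  (forall t, 0 <= f t <= 1) -> 0 <= v -> (forall n, tail_var f n <= v) ->
  forall n,
  \sum_(t < n) delay rho f t - \sum_(t < n) f t <= r /\
  tail_var (delay rho f) n <= v + r ^+ 2.
Proof.
move=> /andP[rho0 rho1] r0 rhor f01 v0 fv n.
(* The lower bound 0 joins the induction so that the difference of the means can be squared. *)
suff : 0 <= \sum_(t < n) delay rho f t - \sum_(t < n) f t <= r /\
  tail_var (delay rho f) n <= v + r ^+ 2 by case=> /andP[].
elim: n => [|n [/andP[IH1 IH2] IH3]].
  by rewrite /tail_var !big_ord0 expr0n subrr lexx r0 addr_ge0// sqr_ge0.
have sS : \sum_(t < n.+1) delay rho f t =
    1 + (1 - rho) * (\sum_(t < n) delay rho f t) + rho * \sum_(t < n) f t.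
  rewrite big_ord_recl /= -addrA; congr (_ + _).
  by rewrite !mulr_sumr -big_split.
have sS2 : \sum_(t < n.+1) (2 * t%:R + 1) * delay rho f t =
    1 + (1 - rho) * (\sum_(t < n) (2 * t%:R + 1) * delay rho f t
                     + 2 * \sum_(t < n) delay rho f t)
    + rho * (\sum_(t < n) (2 * t%:R + 1) * f t + 2 * \sum_(t < n) f t).
  rewrite big_ord_recl /= mulr0 add0r mulr1 -addrA; congr (_ + _).
  rewrite !mulr_sumr -!big_split /= !mulr_sumr -big_split /=.
  by apply: eq_bigr => t _; rewrite /bump /= add1n -natr1; ring.
have := fv n; move: IH3; rewrite /tail_var sS2 sS [\sum_(t < n.+1) f t]big_ord_recr /=.
have /andP[] := f01 n.
move: IH1 IH2.
move: (f n) (\sum_(t < n) delay rho f t) (\sum_(t < n) f t) => fn a b.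
move: (\sum_(t < n) _ * f t) => s2f; move: (\sum_(t < n) _) => s2e.
move=> ab abr fn0 fn1 ve vf.
have d0 : 0 <= (1 - rho) * (a - b) by rewrite mulr_ge0// subr_ge0.
have d1 : (1 - rho) * (a - b) <= (1 - rho) * r by rewrite ler_wpM2l// subr_ge0.
split; first by apply/andP; split; lra.
have d2 : (a - b) ^+ 2 <= r ^+ 2 by rewrite lerXn2r// nnegrE.
have e1 : (1 - rho) * (s2e - a ^+ 2) <= (1 - rho) * (v + r ^+ 2).
  by rewrite ler_wpM2l// subr_ge0.
have e2 : rho * (s2f - b ^+ 2) <= rho * v by rewrite ler_wpM2l.
have e3 : rho * (1 - rho) * (a - b) ^+ 2 <= rho * (1 - rho) * r ^+ 2.
  by rewrite ler_wpM2l// mulr_ge0// subr_ge0.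
have e4 : 0 <= rho ^+ 2 * r ^+ 2 by rewrite mulr_ge0// sqr_ge0.
lra.
Qed.

End ExpectedMaximum.

(** * Probability of being entirely blue after [t] rounds *)

Section FullProbability.
Variable R : realType.

(** The kernel is a parameter so as to serve both [rzf_trans] and [component_trans]. *)
Fixpoint full_prob (T : finType) (p : {set T} -> {set T} -> R) (t : nat)
    (B : {set T}) : R :=
  if t is t'.+1 then \sum_B' p B B' * full_prob p t' B' else (B == [set: T]%SET)%:R.

Lemma full_prob_rzf_setT (G : digraph) t :
  full_prob (@rzf_trans R G) t [set: G]%SET = 1.
Proof.
elim: t => [|t IH] /=; first by rewrite eqxx.
rewrite -(RZFExistence.rzf_trans_sum R [set: G]%SET).
apply: eq_bigr => B _; have [->|BT] := eqVneq B [set: G]%SET; first by rewrite IH mulr1.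
rewrite /rzf_trans (_ : (_ \subset B) = false) ?mul0r// .
by apply/negbTE; rewrite finset.subTset.
Qed.

Lemma onem_full_probS (G : digraph) t (B : {set G}) :
  1 - full_prob (@rzf_trans R G) t.+1 B =
  \sum_B' rzf_trans R B B' * (1 - full_prob (@rzf_trans R G) t B').
Proof.
rewrite -{1}(RZFExistence.rzf_trans_sum R B) -sumrB.
by apply: eq_bigr => B' _; rewrite mulrBr mulr1.
Qed.

Lemma full_prob_rzf_bounds (G : digraph) t (B : {set G}) :
  0 <= full_prob (@rzf_trans R G) t B <= 1.
Proof.
elim: t B => [|t IH] B /=; first by case: eqP; rewrite ?lexx ler01.
apply/andP; split.
  apply: sumr_ge0 => B' _; rewrite mulr_ge0 ?RZFExistence.rzf_trans_ge0//.
  by case/andP: (IH B').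
rewrite -(RZFExistence.rzf_trans_sum R B); apply: ler_sum => B' _.
rewrite -[leRHS]mulr1 ler_wpM2l ?RZFExistence.rzf_trans_ge0//.
by case/andP: (IH B').
Qed.

End FullProbability.

(** * From the law of a realization to [full_prob] *)

Section Avoidance.
Local Open Scope classical_set_scope.
Local Open Scope ring_scope.
Context {R : realType} {G : digraph} {v : G} (X : rzf_process R v).
Local Notation P := (rzf_prob X).
Local Notation full := ([set: G]%SET).

Lemma measurable_blue_pred t (Q : {set G} -> Prop) :
  measurable [set x | Q (blue X t x)].
Proof.
rewrite (_ : mkset _ = \bigcup_(B in [set B | Q B]) [set x | blue X t x = B]).
  apply: fin_bigcup_measurable; first exact: finite_finset.
  by move=> B _; exact: measurable_blue.
apply/seteqP; split => x /=; first by move=> Qx; exists (blue X t x).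
by move=> [B QB /= ->].
Qed.

Lemma measurable_blue_lt t (Q : nat -> {set G} -> Prop) :
  measurable [set x | forall i, (i < t)%N -> Q i (blue X i x)].
Proof.
rewrite (_ : mkset _ = \bigcap_(i in `I_t) [set x | Q i (blue X i x)]).
  apply: fin_bigcap_measurable => // i _; exact: measurable_blue_pred.
by apply/seteqP; split => x.
Qed.

Lemma prob_sum_blue t (A : set (rzf_space X)) : measurable A ->
  P A = (\sum_(B : {set G}) P (A `&` [set x | blue X t x = B]))%E.
Proof.
move=> mA; have m B : measurable (A `&` [set x | blue X t x = B]).
  by apply: measurableI => //; exact: measurable_blue.
have {1}-> : A = \bigcup_(B in [set` (predT : {pred {set G}})]) (A `&` [set x | blue X t x = B]).
  apply/seteqP; split => x; first by move=> Ax; exists (blue X t x).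
  by move=> [B _ []].
rewrite measure_fin_bigcup => [|||B _]; last exact: m.
- rewrite -(bigfs _ (r := enum {set G})) ?enum_uniq// => [|i _].
    by rewrite big_enum.
  by rewrite mem_enum.
- exact: finite_finset.
- by move=> B B' _ _ [x [[_ /= <-] [_ /= <-]]].
Qed.

(** [blue_markov] speaks of whole histories, so the induction on [t] carries an arbitrary prefix and
    splits on the blue set at round [s.+1]. Avoidance has probability [1 - full_prob] because the
    full set is absorbing. *)
Lemma prob_path_avoid s t (B : nat -> {set G}) :
  P [set x | (forall i, (i <= s)%N -> blue X i x = B i) /\
             (forall j, (j <= t)%N -> blue X (s + j)%N x <> full)] =
  (P [set x | forall i, (i <= s)%N -> blue X i x = B i] *
   (1 - full_prob (@rzf_trans R G) t (B s))%:E)%E.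
Proof.
elim: t s B => [|t IH] s B.
  have [Bs|Bs] := eqVneq (B s) full.
    rewrite Bs full_prob_rzf_setT subrr mule0 (_ : mkset _ = classical_sets.set0) ?measure0//.
    apply/seteqP; split => x //= [h1 /(_ 0%N isT)]; rewrite addn0; apply.
    by rewrite h1.
  rewrite /= (negbTE Bs) subr0 mule1; congr (P _).
  apply/seteqP; split => x /=; first by case.
  move=> h; split=> // j; rewrite leqn0 => /eqP ->; rewrite addn0 h//.
  exact/eqP.
have [Bs|Bs] := eqVneq (B s) full.
  rewrite Bs full_prob_rzf_setT subrr mule0 (_ : mkset _ = classical_sets.set0) ?measure0//.
  apply/seteqP; split => x //= [h1 /(_ 0%N isT)]; rewrite addn0; apply.
  by rewrite h1.
rewrite (@prob_sum_blue s.+1); last first.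
  apply: measurableI; first exact: (@measurable_blue_lt s.+1 (fun i b => b = B i)).
  pose Q i (b : {set G}) := (s <= i)%N -> b <> full.
  rewrite (_ : (fun x => _) = [set x | forall i, (i < (s + t.+1).+1)%N -> Q i (blue X i x)]).
    exact: measurable_blue_lt.
  apply/seteqP; split => x /= h.
    by move=> i it si; rewrite -(subnKC si); apply: h; rewrite leq_subLR -ltnS.
  by move=> j jt; apply: h; rewrite ?ltnS ?leq_add2l// leq_addr.
pose B1 b i := if i == s.+1 then b else B i.
rewrite (eq_bigr (fun b => P [set x | (forall i, (i <= s.+1)%N -> blue X i x = B1 b i) /\
             (forall j, (j <= t)%N -> blue X (s.+1 + j)%N x <> full)])); last first.
  move=> b _; congr (P _); apply/seteqP; split => x /=.
    move=> [[h1 h2] h3]; split=> [i|j jt].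
      rewrite leq_eqVlt /B1 => /orP[/eqP ->|]; first by rewrite eqxx.
      by rewrite ltnS => is_; rewrite ltn_eqF ?ltnS//; exact: h1.
    by rewrite addSnnS; apply: h2.
  move=> [h1 h2]; have h3 i : (i <= s)%N -> blue X i x = B i.
    by move=> is_; rewrite h1 ?(leqW is_)// /B1 ltn_eqF ?ltnS.
  split; last by rewrite h1// /B1 eqxx.
  split=> // -[|j] jt; last by rewrite -addSnnS; apply: h2.
  by rewrite addn0 h3//; exact/eqP.
under eq_bigr => b _.
  rewrite IH blue_markov /B1 eqxx ltn_eqF//.
  rewrite (_ : mkset _ = [set x | forall i, (i <= s)%N -> blue X i x = B i]); last first.
    apply/seteqP; split => x /= h i is_; have := h i is_; by rewrite ltn_eqF.
  rewrite -muleA -EFinM.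
  over.
rewrite onem_full_probS -sumEFin -ge0_sume_distrr// => b _.
rewrite lee_fin mulr_ge0 ?RZFExistence.rzf_trans_ge0// subr_ge0.
by case/andP: (full_prob_rzf_bounds R t b).
Qed.

(** A realization is monotone only almost surely; asking for every round up to [n] makes this the
    event [prop_time > n] pointwise. *)
Definition not_full n : set (rzf_space X) :=
  [set x | forall j, (j <= n)%N -> blue X j x <> full].

Lemma measurable_not_full n : measurable (not_full n).
Proof. exact: (@measurable_blue_lt n.+1 (fun _ b => b <> full)). Qed.

Lemma prob_not_full n :
  P (not_full n) = (1 - full_prob (@rzf_trans R G) n [set v]%SET)%:E.
Proof.
have := @prob_path_avoid 0 n (fun=> [set v]%SET).
rewrite [X in (P X * _)%E](_ : _ = setT); last first.
  by apply/seteqP; split => x //= _ i; rewrite leqn0 => /eqP ->; rewrite blue0.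
rewrite probability_setT mul1e => <-; congr (P _).
apply/seteqP; split => x /=; last by case.
by move=> h; split=> // i; rewrite leqn0 => /eqP ->; rewrite blue0.
Qed.

End Avoidance.
Arguments not_full {R G v} X n.

(** * Mean and variance of the propagation time from its tail *)

Section PropagationTail.
Local Open Scope classical_set_scope.
Local Open Scope ring_scope.
Context {R : realType} {G : digraph} {v : G} (X : rzf_process R v).
Local Notation P := (rzf_prob X).

Lemma prop_timeP x :
  (exists k, prop_time x = k%:R%:E /\ forall n, not_full X n x <-> (n < k)%N) \/
  (prop_time x = +oo%E /\ forall n, not_full X n x).
Proof.
have [|h] := pselect (exists k, blue X k x == [set: G]%SET); last first.
  right; split; last by move=> n j _ /eqP e; apply: h; exists j.
  apply/eqP; rewrite -leye_eq; apply: le_ereal_inf_tmp => _ [t /= /eqP e <-].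
  by exfalso; apply: h; exists t.
move=> ex; left; have [k /eqP bk kmin] := ex_minnP ex; exists k; split.
  apply/eqP; rewrite eq_le; apply/andP; split.
    by apply: ereal_inf_lbound; exists k.
  apply: le_ereal_inf_tmp => _ [t /= bt <-]; rewrite lee_fin ler_nat.
  by apply: kmin; apply/eqP.
move=> n; split => [h|nk j jn /eqP /kmin].
  by rewrite ltnNge; apply/negP => kn; exact: (h k kn).
by rewrite leqNgt (leq_ltn_trans jn nk).
Qed.

Lemma sum_ltn_minn k n : \sum_(t < n) (t < k)%N%:R = (minn n k)%:R :> R.
Proof.
elim: n => [|n IH]; first by rewrite big_ord0 min0n.
rewrite big_ord_recr /= IH -natrD; congr (_%:R).
by case: ltnP => nk; [rewrite (minn_idPl nk) addn1
                      |rewrite (minn_idPr (leqW nk)) addn0].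
Qed.

Lemma sum_odd_ltn_minn k n :
  \sum_(t < n) (2 * t%:R + 1) * (t < k)%N%:R = (minn n k)%:R ^+ 2 :> R.
Proof.
elim: n => [|n IH]; first by rewrite big_ord0 min0n expr0n.
rewrite big_ord_recr /= IH; case: ltnP => nk.
  by rewrite (minn_idPl nk) mulr1 -natr1; ring.
by rewrite mulr0 addr0 (minn_idPr (leqW nk)).
Qed.

Lemma indic_not_full_fin k x t : (not_full X t x <-> (t < k)%N) ->
  \1_(not_full X t) x = (t < k)%N%:R :> R.
Proof.
by move=> h; rewrite indicE; congr ((nat_of_bool _)%:R); apply/idP/idP; rewrite inE => /h.
Qed.

Lemma prop_time_series x :
  prop_time x = (\sum_(0 <= n <oo) (\1_(not_full X n) x)%:E)%E.
Proof.
have i0 n : (0 <= (\1_(not_full X n) x : R)%:E)%E by rewrite lee_fin.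
case: (prop_timeP x) => [[k [-> h]]|[-> h]].
  rewrite (@nneseries_split _ _ 0 k)// add0n [X in (_ + X)%E]eseries0 ?adde0.
    rewrite big_mkord sumEFin; congr EFin.
    rewrite (eq_bigr (fun t : 'I_k => (t < k)%N%:R)) ?sum_ltn_minn ?minnn// => t _.
    exact/indic_not_full_fin/h.
  move=> i ki _; rewrite (@indic_not_full_fin k)//; first by rewrite ltnNge ki.
apply/esym/eqyP => A A0; pose n := (Num.trunc A).+1.
apply: (@le_trans _ _ n%:R%:E); first by rewrite lee_fin ltW// truncnS_gt.
apply: (le_trans _ (@nneseries_lim_ge _ _ xpredT 0 n (fun i _ _ => i0 i))).
rewrite big_mkord sumEFin lee_fin (eq_bigr (fun=> 1)) ?sumr_const ?card_ord//.
by move=> t _; rewrite indicE mem_set.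
Qed.

Local Notation tail t := (1 - full_prob (@rzf_trans R G) t [set v]%SET).

Lemma integral_prop_time :
  (\int[P]_x prop_time x = \sum_(0 <= n <oo) (tail n)%:E)%E.
Proof.
under eq_integral do rewrite prop_time_series.
rewrite integral_nneseries//.
  apply: eq_eseriesr => n _; rewrite -(prob_not_full X) integral_indic ?setIT//.
  exact: measurable_not_full.
by move=> n; apply/measurable_EFinP/measurable_indic/measurable_not_full.
Qed.

Lemma measurable_prop_time : measurable_fun setT (@prop_time R G v X).
Proof.
rewrite (_ : @prop_time R G v X =
    fun x => (\sum_(0 <= n <oo | n \in xpredT) (\1_(not_full X n) x)%:E)%E).
  apply: ge0_emeasurable_sum => // n _.
  by apply/measurable_EFinP/measurable_indic/measurable_not_full.
by apply/funext => x; rewrite prop_time_series.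
Qed.

Lemma prop_time_ge0 x : (0 <= prop_time (X := X) x)%E.
Proof. by rewrite prop_time_series nneseries_ge0// => n _ _; rewrite lee_fin. Qed.

Lemma tail_ge0 t : 0 <= tail t.
Proof. by rewrite subr_ge0; case/andP: (full_prob_rzf_bounds R t [set v]%SET). Qed.

Lemma sum_tail_le_ept n : ((\sum_(t < n) tail t)%:E <= ept_rzf X)%E.
Proof.
rewrite /ept_rzf; case: asboolP => _; last by rewrite leey.
rewrite integral_prop_time -sumEFin -(big_mkord predT (fun t => (tail t)%:E)).
by apply: nneseries_lim_ge => i _ _; rewrite lee_fin tail_ge0.
Qed.

Lemma ept_rzf_le (M : R) : (forall n, \sum_(t < n) tail t <= M) ->
  (ept_rzf X <= M%:E)%E.
Proof.
move=> hM; rewrite /ept_rzf; case: asboolP => [_|h].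
  rewrite integral_prop_time; apply: lime_le.
    by apply: is_cvg_nneseries => i _ _; rewrite lee_fin tail_ge0.
  by apply: nearW => n; rewrite big_mkord sumEFin lee_fin.
(* If coloring were impossible, every tail would be 1 and [n > M] of them would exceed [M]. *)
exfalso; apply: h; pose n := (Num.trunc M).+1.
have [t tn] : exists t, tail t < 1.
  apply: contrapT => h; have := hM n; apply/negP; rewrite -ltNge.
  apply: (lt_le_trans (truncnS_gt M)).
  rewrite -/n -[X in X%:R <= _]card_ord -sumr_const; apply: ler_sum => t _.
  by rewrite leNgt; apply/negP => ht; apply: h; exists t.
apply: contrapT => h; have z j : P [set x | blue X j x = [set: G]%SET] = 0%E.
  apply/eqP; rewrite eq_le measure_ge0 andbT leNgt; apply/negP => hj; apply: h.
  by exists j.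
have neg : P.-negligible (\bigcup_j [set x | blue X j x = [set: G]%SET]).
  apply: negligible_bigcup => j; apply/negligibleP; last exact: z.
  exact: measurable_blue.
have : P (~` not_full X t) = 0%E.
  apply: measure_negligible; first exact/measurableC/measurable_not_full.
  apply: negligibleS neg => x; apply: contra_notP => h2 j jt e.
  by apply: h2; exists j.
rewrite probability_setC ?prob_not_full//; last exact: measurable_not_full.
move=> /eqP; rewrite -EFinB eqe => /eqP e; move: tn; lra.
Qed.

Lemma integral_sum_not_full (c : nat -> R) n : (forall t, 0 <= c t) ->
  (\int[P]_x (\sum_(t < n) c t * \1_(not_full X t) x)%:E =
   (\sum_(t < n) c t * tail t)%:E)%E.
Proof.
move=> c0; under eq_integral do rewrite -sumEFin.
have m (t : nat) : measurable_fun setT (fun x => (\1_(not_full X t) x : R)%:E).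
  by apply/measurable_EFinP/measurable_indic/measurable_not_full.
rewrite ge0_integral_sum//.
- rewrite -sumEFin; apply: eq_bigr => t _.
  under eq_integral do rewrite EFinM.
  rewrite ge0_integralZl_EFin// integral_indic ?setIT//; last exact: measurable_not_full.
  by rewrite EFinM -(prob_not_full X).
- move=> t; under eq_fun do rewrite EFinM.
  exact: measurable_funeM.
- by move=> t x _; rewrite lee_fin mulr_ge0.
Qed.

(** The left side is the variance of the time truncated at [n]; it is at most the second moment
    about [a], which is at most the variance of the untruncated time. *)
Lemma var_tail_le n : (ept_rzf X < +oo)%E ->
  ((\sum_(t < n) (2 * t%:R + 1) * tail t - (\sum_(t < n) tail t) ^+ 2)%:E
   <= var_prop_time X)%E.
Proof.
rewrite /ept_rzf; case: asboolP => // _ fin.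
pose W (x : rzf_space X) : R := fine (prop_time x).
rewrite /var_prop_time /variance covariance.unlock; set c := fine _.
rewrite expectation.unlock.
have W0 x : 0 <= W x by rewrite fine_ge0// prop_time_ge0.
have c0 : 0 <= c.
  by rewrite fine_ge0// expectation.unlock; apply: integral_ge0 => x _; rewrite lee_fin W0.
pose a := Num.min c n%:R.
have a0 : 0 <= a by rewrite le_min c0 ler0n.
pose w (x : rzf_space X) : R := \sum_(t < n) \1_(not_full X t) x.
have mw : measurable_fun setT w.
  apply: measurable_sum => t; exact/measurable_indic/measurable_not_full.
have mW : measurable_fun setT W.
  by apply: measurableT_comp => //; exact: measurable_prop_time.
have ae : {ae P, forall x, prop_time x \is a fin_num}.
  have : {ae P, forall x, setT x -> prop_time (X := X) x \is a fin_num}.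
    apply: integrable_ae => //; apply/integrableP; split.
      exact: measurable_prop_time.
    by under eq_integral do rewrite gee0_abs ?prop_time_ge0//.
  by apply: filterS => x; apply.
have fink x : prop_time x \is a fin_num -> exists k, W x = k%:R /\
    forall t, \1_(not_full X t) x = (t < k)%N%:R :> R.
  case: (prop_timeP x) => [[k [e h]] _|[-> //]]; exists k; split.
    by rewrite /W e.
  by move=> t; exact/indic_not_full_fin/h.
(* [w] and [a] are the truncations of [W] and [c] at [n], and truncation is
   1-Lipschitz. *)
have le1 : (\int[P]_x ((w x - a) ^+ 2)%:E <=
   \int[P]_x (((W \- cst c) * (W \- cst c))%R x)%:E)%E.
  apply: ae_ge0_le_integral => //.
  - by move=> x _; rewrite lee_fin sqr_ge0.
  - apply/measurable_EFinP; apply: measurable_funX; exact: measurable_funB.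
  - by move=> x _; rewrite lee_fin -expr2 sqr_ge0.
  - by apply/measurable_EFinP; apply: measurable_funM; exact: measurable_funB.
  apply: filterS ae => x /fink [k [Wk h]] _.
  rewrite lee_fin (_ : ((W \- cst c) * (W \- cst c)) x = (W x - c) ^+ 2) // Wk /w.
  rewrite (eq_bigr (fun t : 'I_n => (t < k)%N%:R)) => [|t _]; last exact: h.
  rewrite sum_ltn_minn /a.
  case: (leqP n k) => nk; case: (leP c n%:R) => cn.
  - have : n%:R <= k%:R :> R by rewrite ler_nat.
    nra.
  - by rewrite subrr expr0n sqr_ge0.
  - by [].
  - have : k%:R < n%:R :> R by rewrite ltr_nat.
    nra.
apply: le_trans le1.
(* The expanded square, arranged with nonnegative terms on both sides so that the integrals add
   up. *)
have key : (\int[P]_x ((w x - a) ^+ 2)%:E + (\sum_(t < n) (2 * a) * tail t)%:E =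
  (\sum_(t < n) (2 * t%:R + 1) * tail t)%:E + (a ^+ 2)%:E)%E.
  rewrite -(@integral_sum_not_full (fun=> 2 * a)); last by move=> _; rewrite mulr_ge0.
  rewrite -(@integral_sum_not_full (fun t => 2 * t%:R + 1)); last first.
    by move=> t; rewrite addr_ge0// mulr_ge0.
  have cstE : (\int[P]_x (cst (a ^+ 2)%:E x) = (a ^+ 2)%:E)%E.
    rewrite integral_cst//. rewrite [X in (_ * X)%E]probability_setT mule1//.
  rewrite -[X in (_ = _ + X)%E]cstE.
  have mc (b : nat -> R) :
      measurable_fun setT (fun x => (\sum_(t < n) b t * \1_(not_full X t) x)%:E).
    apply/measurable_EFinP; apply: measurable_sum => t.
    by apply: measurable_funM => //; exact/measurable_indic/measurable_not_full.
  have mwa : measurable_fun setT (fun x => ((w x - a) ^+ 2)%:E).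
    by apply/measurable_EFinP; apply: measurable_funX; exact: measurable_funB.
  rewrite -!ge0_integralD//.
  - apply: eq_integral => x _; rewrite -!EFinD; congr EFin.
    have [k hk] : exists k, forall t, (t < n)%N -> \1_(not_full X t) x = (t < k)%N%:R :> R.
      case: (prop_timeP x) => [[k [_ h]]|[_ h]].
        by exists k => t _; exact/indic_not_full_fin/h.
      by exists n => t tn; rewrite tn indicE mem_set.
    rewrite /w (eq_bigr (fun t : 'I_n => (t < k)%N%:R)) => [|t _]; last exact: hk.
    rewrite sum_ltn_minn -mulr_sumr.
    rewrite (eq_bigr (fun t : 'I_n => (t < k)%N%:R)) => [|t _]; last exact: hk.
    rewrite sum_ltn_minn.
    under eq_bigr => t _ do rewrite hk//.
    by rewrite sum_odd_ltn_minn; ring.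
  - by move=> x _; rewrite lee_fin sumr_ge0// => t _; rewrite mulr_ge0// addr_ge0// mulr_ge0.
  - exact: (mc (fun t => 2 * t%:R + 1)).
  - by move=> x _; rewrite lee_fin sqr_ge0.
  - by move=> x _; rewrite lee_fin sqr_ge0.
  - by move=> x _; rewrite lee_fin sumr_ge0// => t _; rewrite !mulr_ge0.
  - exact: (mc (fun=> 2 * a)).
move: key; case: (\int[P]_x _)%E => // I /=.
rewrite lee_fin => /eqP; rewrite -!EFinD eqe => /eqP.
rewrite -mulr_sumr.
have := sqr_ge0 (\sum_(t < n) tail t - a).
move: (\sum_(t < n) tail t) => s1; move: (\sum_(t < n) _) => s2.
nra.
Qed.
End PropagationTail.

Lemma Tagged_inj (I : eqType) (T : I -> eqType) (i : I) :
  injective (fun x : T i => Tagged T x).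
Proof. by move=> x y /eqP; rewrite eq_Tagged => /eqP. Qed.

(** * Independence of the components of the join *)

Section Join.
Variables (R : realType) (m : nat) (G : 'I_m -> digraph) (v : forall i, G i).
Local Notation K := (join v).

Definition component (B : {set K}) (i : 'I_m) : {set G i} :=
  [set x | join_inj v x \in B]%SET.

(** Sets containing b correspond to families of subsets of the [G i], so this is distributivity. As
    [{set G i}] depends on [i], subsets are first moved into the disjoint union [V], each inside its
    fibre. *)
Lemma sum_prod_component (F : forall i, {set G i} -> R) :
  \sum_(B : {set K} | None \in B) \prod_i F i (component B i) =
  \prod_i \sum_(A : {set G i}) F i A.
Proof.
pose V := {i : 'I_m & G i}.
pose fibre i (S : {set V}) := S \subset [set x : V | tag x == i]%SET.
pose part i (S : {set V}) : {set G i} := [set x | Tagged G x \in S]%SET.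
have -> : \prod_i \sum_(A : {set G i}) F i A =
    \prod_i \sum_(S | fibre i S) F i (part i S).
  apply: eq_bigr => i _.
  rewrite [RHS](reindex_onto (fun A : {set G i} => [set Tagged G x | x in A]%SET) (part i)) /=.
    apply: eq_big => [A|A _].
      rewrite (_ : fibre i _); last first.
        by apply/fintype.subsetP => _ /imsetP[x _ ->]; rewrite inE.
      apply/esym/eqP/setP => x; rewrite inE; apply/imsetP/idP => [[y yA e]|xA].
        by rewrite (Tagged_inj e).
      by exists x.
    by congr (F i _); apply/setP => x; rewrite inE mem_imset//; exact: Tagged_inj.
  move=> S /fintype.subsetP fS; apply/setP => -[j x]; apply/imsetP/idP.
    by move=> [y]; rewrite inE => yS ->.
  move=> xS; have := fS _ xS; rewrite inE /= => /eqP e; subst j.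
  by exists x; rewrite ?inE.
rewrite bigA_distr_big_dep /=.
pose glue (f : {ffun 'I_m -> {set V}}) : {set K} :=
  [set y : K | if y is Some x then x \in f (tag x) else true]%SET.
pose cut (B : {set K}) := [ffun i : 'I_m => [set x : V | (tag x == i) && (Some x \in B)]%SET].
rewrite (reindex_onto glue cut) /=; last first.
  by move=> B NB; apply/setP => -[x|]; rewrite !inE ?ffunE ?inE ?eqxx.
apply: eq_big => [f|f _].
  rewrite inE /=; apply/eqP/familyP => [<- i|hf].
    by rewrite ffunE; apply/fintype.subsetP => x; rewrite !inE => /andP[].
  apply/ffunP => i; rewrite ffunE; apply/setP => x; rewrite !inE.
  have [<-//|ti] := eqVneq (tag x) i.
  apply/esym/negbTE/negP => xf; have /fintype.subsetP := hf i.
  by move=> /(_ x xf); rewrite inE (negbTE ti).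
by apply: eq_bigr => i _; congr (F i _); apply/setP => x; rewrite !inE.
Qed.

(* One round of the process restricted to [G i], once b is blue. *)
Definition join_force_prob i (A : {set G i}) (w : G i) : R :=
  (#|[set u in A | Defs.arc u w]|%SET + (w == v i))%:R / (indegree w + (w == v i))%:R.

(** The product covers blue vertices too, as in [rzf_transE], so that these products multiply to the
    one over all vertices of the join except b. *)
Definition component_trans i (A A' : {set G i}) : R :=
  \prod_w (if w \in A then (w \in A')%:R
           else if w \in A' then join_force_prob A w else 1 - join_force_prob A w).

Lemma rzf_transE (H : digraph) (B B' : {set H}) :
  rzf_trans R B B' =
  \prod_w (if w \in B then (w \in B')%:R
           else if w \in B' then force_prob R B w else 1 - force_prob R B w).
Proof.
rewrite (bigID (mem B)) /= /rzf_trans; congr (_ * _); last first.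
  by apply: eq_bigr => w /negbTE ->.
case: (boolP (B \subset B')) => BB'.
  by rewrite big1// => w wB; rewrite wB (fintype.subsetP BB').
by case/fintype.subsetPn: BB' => w wB wB'; rewrite (bigD1 w)//= wB (negbTE wB') mul0r.
Qed.

Lemma card_join_pred (B : {set K}) i (w : G i) : None \in B ->
  #|[set u in B | Defs.arc u (join_inj v w)]|%SET =
  (#|[set u in component B i | Defs.arc u w]|%SET + (w == v i))%N.
Proof.
move=> NB; rewrite (cardsD1 None) inE NB /= addnC eq_sym; congr (_ + _)%N.
have inj : injective (fun u : G i => join_inj v u).
  by move=> x y [] /Tagged_inj.
rewrite -(card_imset _ inj); apply: eq_card => -[[j u]|]; rewrite !inE /=; last first.
  by apply/esym/imsetP => -[].
apply/andP/imsetP => [[uB /andP[/eqP e]]|[x]].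
  subst j; rewrite tagged_asE => uw; exists u => //.
  by rewrite !inE uB.
rewrite !inE => /andP[xB xw] e.
have ej : j = i := congr1 (fun o => if o is Some p then tag p else i) e.
by subst j; rewrite (inj _ _ e) tagged_asE eqxx.
Qed.

Lemma indegree_join i (w : G i) :
  indegree (join_inj v w) = (indegree w + (w == v i))%N.
Proof.
have := @card_join_pred [set: K]%SET i w; rewrite inE => /(_ isT) e.
rewrite /indegree -[LHS](_ : #|[set u in [set: K]%SET | Defs.arc u (join_inj v w)]|%SET = _).
  by rewrite e; congr (_ + _)%N; apply: eq_card => u; rewrite !inE.
by apply: eq_card => u; rewrite !inE.
Qed.

Lemma force_prob_join (B : {set K}) i (w : G i) : None \in B ->
  force_prob R B (join_inj v w) = join_force_prob (component B i) w.
Proof.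
by move=> NB; rewrite /force_prob card_join_pred// indegree_join.
Qed.

Lemma rzf_trans_join (B B' : {set K}) : None \in B -> None \in B' ->
  rzf_trans R B B' = \prod_i component_trans (component B i) (component B' i).
Proof.
move=> NB NB'; rewrite rzf_transE (bigD1 None)//= NB NB' mul1r.
rewrite (reindex_omap Some id) => [|[x|]]//=.
rewrite /component_trans sig_big_dep /=; apply: eq_big => [x|[i w] _].
  by rewrite eqxx.
by rewrite /= -force_prob_join// !inE.
Qed.

(** While b is blue the kernel factors over the components, and [sum_prod_component] carries this
    through each round; sets that lose b have transition probability 0. *)
Lemma full_prob_join t (B : {set K}) : None \in B ->
  full_prob (@rzf_trans R K) t B =
  \prod_i full_prob (@component_trans i) t (component B i).
Proof.
elim: t B => [|t IH] B NB /=.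
  have [->|BT] := eqVneq B [set: K]%SET.
    rewrite big1// => i _; rewrite (_ : component _ _ = finset.setT) ?eqxx//.
    by apply/setP => x; rewrite !inE.
  have [[[i x]|] xB] : exists x, x \notin B.
  - apply/existsP; rewrite -negb_forall; apply: contra BT => /forallP h.
    by apply/eqP/setP => x; rewrite h inE.
  - rewrite (bigD1 i)//= (_ : (_ == _) = false) ?mul0r//.
    apply/negbTE; apply: contra xB => /eqP/setP/(_ x).
    by rewrite !inE.
  - by rewrite NB in xB.
rewrite -sum_prod_component [LHS](bigID (fun B' : {set K} => None \in B')) /=.
rewrite [X in _ + X]big1 ?addr0; last first.
  move=> B' NB'; rewrite /rzf_trans (_ : (_ \subset _) = false) ?mul0r//.
  by apply/negbTE/fintype.subsetPn; exists None.
by apply: eq_bigr => B' NB'; rewrite IH// rzf_trans_join// big_split.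
Qed.

(** The edge from b alters the forcing probability only at [v i], which is already blue. *)
Lemma component_trans_rzf i (A A' : {set G i}) : v i \in A ->
  component_trans A A' = rzf_trans R A A'.
Proof.
move=> vA; rewrite rzf_transE; apply: eq_bigr => w _.
case: ifPn => // wA; rewrite /join_force_prob (_ : (w == v i) = false) ?addn0 ?addr0//.
by apply: contraNF wA => /eqP ->.
Qed.

Lemma full_prob_component t i (A : {set G i}) : v i \in A ->
  full_prob (@component_trans i) t A = full_prob (@rzf_trans R (G i)) t A.
Proof.
elim: t A => [|t IH] A vA //=; apply: eq_bigr => A' _.
rewrite component_trans_rzf//; case: (boolP (v i \in A')) => vA'; first by rewrite IH.
rewrite /rzf_trans (_ : (_ \subset _) = false) ?mul0r//.
by apply/negbTE/fintype.subsetPn; exists (v i).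
Qed.

(** From an all-white component only [v i] can be forced, by b alone among its in-neighbors, so the
    next set is empty or [[set v i]]. This is one trial of the geometric wait. *)
Lemma full_prob_component0 t i :
  full_prob (@component_trans i) t.+1 finset.set0 =
  (1 - (indegree (v i)).+1%:R^-1) * full_prob (@component_trans i) t finset.set0 +
  (indegree (v i)).+1%:R^-1 * full_prob (@rzf_trans R (G i)) t [set v i]%SET.
Proof.
have fp0 w : join_force_prob finset.set0 w =
    if w == v i then (indegree (v i)).+1%:R^-1 else 0.
  rewrite /join_force_prob (_ : [set u in _ | _]%SET = finset.set0); last first.
    by apply/setP => u; rewrite !inE.
  by rewrite cards0 add0n; case: eqP => [->|_]; rewrite ?mul0r// addn1 mul1r.
have trans0 A : component_trans finset.set0 A =
    \prod_(w : G i) (if w == v i then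
       (if w \in A then (indegree (v i)).+1%:R^-1 else 1 - (indegree (v i)).+1%:R^-1)
       else (w \notin A)%:R).
  apply: eq_bigr => w _; rewrite inE fp0; case: (w == v i) => //.
  by case: (w \in A) => //=; rewrite subr0.
rewrite /= (bigD1 finset.set0)//= (bigD1 [set v i]%SET)//=; last first.
  by apply/eqP => /setP/(_ (v i)); rewrite !inE eqxx.
rewrite [X in _ + (_ + X)]big1 ?addr0.
  congr (_ * _ + _ * _); last by rewrite full_prob_component ?inE.
    by rewrite trans0 (bigD1 (v i))//= eqxx inE big1 ?mulr1// => w /negbTE ->; rewrite inE.
  by rewrite trans0 (bigD1 (v i))//= eqxx inE eqxx big1 ?mulr1// => w /negbTE h; rewrite h inE h.
move=> A /andP[A0 Av].
have [w wA wv] : exists2 w, w \in A & w != v i.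
  apply/exists_inP; apply: contraNT Av => /exists_inPn h.
  have sA : A \subset [set v i]%SET.
    by apply/fintype.subsetP => w wA; rewrite inE -[_ == _]negbK h.
  by move: sA; rewrite finset.subset1 (negbTE A0) orbF.
by rewrite trans0 (bigD1 w)//= (negbTE wv) wA !mul0r.
Qed.

End Join.

(** * The tail of the join and the final bound *)

Lemma tail_join (R : realType) (m : nat) (G : 'I_m -> digraph)
    (v : forall i, G i) t :
  1 - full_prob (@rzf_trans R (join v)) t [set join_source v]%SET =
  1 - \prod_i (1 - delay (indegree (v i)).+1%:R^-1
    (fun t => 1 - full_prob (@rzf_trans R (G i)) t [set v i]%SET) t).
Proof.
rewrite full_prob_join ?inE//; congr (1 - _); apply: eq_bigr => i _.
rewrite (_ : component _ _ = finset.set0); last first.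
  by apply/setP => x; rewrite !inE.
elim: t => [|t IH].
  rewrite /= subrr; case: eqP => // /setP/(_ (v i)).
  by rewrite !inE.
by rewrite full_prob_component0 IH /=; ring.
Qed.

(* Extended arithmetic makes the right-hand side [+oo] as soon as one of the
   [ept_rzf (X i)] is [+oo], the other two summands being nonnegative. *)
Theorem proposition5p2 (R : realType) :
  exists2 C : R, 0 < C &
  forall (m : nat) (G : 'I_m -> digraph) (v : forall i, G i)
         (X : forall i, rzf_process R (v i))
         (Y : rzf_process R (join_source v)),
    (0 < m)%N ->
    let r := (\max_(i < m) indegree (join_inj v (v i)))%N in
    (ept_rzf Y <=
     \big[maxe/-oo]_(i < m) ept_rzf (X i)
     + sqrte ((\sum_(i < m) var_prop_time (X i)) * (2^-1)%:E)
     + (C * r%:R * Num.sqrt m%:R)%:E)%E.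
Proof.
(* The errors are [r] from the means, 2 from rounding and [r sqrt m] from the variances; as [r] and
   [m] are at least 1, they total at most [4 r sqrt m]. *)
exists 4 => [|m G v X Y m0]; first by rewrite ltr0n.
cbv zeta; set r := (\max_(i < m) _)%N.
have rE i : indegree (join_inj v (v i)) = (indegree (v i)).+1.
  by rewrite indegree_join eqxx addn1.
have ri i : ((indegree (v i)).+1 <= r)%N.
  by rewrite -rE; exact: (leq_bigmax i).
set M := \big[maxe/-oo%E]_(i < m) _; set V := (\sum_(i < m) _)%E.
have var0 i : (0 <= var_prop_time (X i))%E by exact: variance_ge0.
have ept0 i : (0 <= ept_rzf (X i))%E.
  by have := sum_tail_le_ept (X i) 0; rewrite big_ord0.
have eptM i : (ept_rzf (X i) <= M)%E by exact: le_bigmax.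
have varV i : (var_prop_time (X i) <= V)%E.
  by rewrite /V (bigD1 i)//= leeDl// sume_ge0.
have M0 : (0 <= M)%E by exact: le_trans (ept0 (Ordinal m0)) (eptM _).
have V0 : (0 <= V)%E by exact: sume_ge0.
case: M eptM M0 => [M||] // eptM M0; last first.
  by rewrite addye ?leey// gt_eqF// (lt_le_trans _ (sqrte_ge0 _))// ltNyr.
have VE : V = (\sum_(i < m) var_prop_time (X i))%E by [].
case: V varV V0 VE => [V||] // varV V0 VE; last first.
  by rewrite gt0_mulye ?lte_fin ?invr_gt0 //= leey.
have {}V0 : 0 <= V by rewrite -lee_fin.
have {}M0 : 0 <= M by rewrite -lee_fin.
rewrite -EFinM /= -!EFinD.
apply: ept_rzf_le => n.
under eq_bigr do rewrite tail_join.
pose f i t := 1 - full_prob (@rzf_trans R (G i)) t [set v i]%SET.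
pose rho i : R := (indegree (v i)).+1%:R^-1.
pose w i := fine (var_prop_time (X i)).
have wE i : var_prop_time (X i) = (w i)%:E.
  rewrite fineK// ge0_fin_numE//.
  exact: le_lt_trans (varV i) (ltry _).
have sw : \sum_i w i = V.
  by apply: EFin_inj; rewrite VE -sumEFin; apply: eq_bigr => i _; rewrite wE.
have w0 i : 0 <= w i by rewrite -lee_fin -wE.
have f01 i t : 0 <= f i t <= 1.
  have /andP[h0 h1] := full_prob_rzf_bounds R t [set v i]%SET.
  by rewrite subr_ge0 h1 lerBlDr lerDl.
have fS i t : f i t.+1 <= f i t.
  rewrite -lee_fin -!(prob_not_full (X i)); apply: le_measure; rewrite ?inE.
  - exact: measurable_not_full.
  - exact: measurable_not_full.
  - by move=> x h j jt; apply: h; exact: leqW.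
have fM i k : \sum_(t < k) f i t <= M.
  by rewrite -lee_fin; exact: le_trans (sum_tail_le_ept (X i) k) (eptM i).
have fV i k : tail_var (f i) k <= w i.
  rewrite -lee_fin -wE; apply: var_tail_le.
  exact: le_lt_trans (eptM i) (ltry _).
have rho01 i : 0 <= rho i <= 1.
  by rewrite invr_ge0 ler0n /= invf_le1 ?ltr0n// ler1n.
have rr i : rho i * (indegree (v i)).+1%:R = 1 by rewrite mulVf// pnatr_eq0.
have rle i : (indegree (v i)).+1%:R <= r%:R :> R by rewrite ler_nat.
(* Each geometric wait adds at most [r ^ 2] to the variance. *)
pose S := V + m%:R * r%:R ^+ 2.
have S0 : 0 <= S by rewrite addr_ge0// mulr_ge0// exprn_ge0.
have bnd := @sum_onem_prod_le R _ (fun i => delay (rho i) (f i)) (M + r%:R) S n.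
have {bnd} : \sum_(t < n) (1 - \prod_i (1 - delay (rho i) (f i) t)) <=
    M + r%:R + 2 + Num.sqrt (S / 2).
  apply: bnd => //.
  - move=> i t; have [h _] := delay_bounds (rho01 i) (f01 i) (fS i).
    have /andP[h1 ->] := h t; rewrite andbT (le_trans _ h1)//.
    by case/andP: (f01 i t).
  - by move=> i; exact: (delay_bounds (rho01 i) (f01 i) (fS i)).2.
  - by rewrite addr_ge0.
  - move=> i; have [h _] := delay_moments (rho01 i) (ler0n _ _) (rr i) (f01 i) (w0 i) (fV i) n.
    by rewrite lerBlDr in h; rewrite (le_trans h)// addrC lerD.
  - rewrite /S -sw -[X in X%:R * _]card_ord mulr_natl -sumr_const -big_split /=.
    apply: ler_sum => i _.
    have [_ h] := delay_moments (rho01 i) (ler0n _ _) (rr i) (f01 i) (w0 i) (fV i) n.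
    by rewrite (le_trans h)// lerD2l lerXn2r// nnegrE.
move=> /le_trans; apply.
pose a := Num.sqrt (V / 2); pose b := Num.sqrt m%:R : R.
have a0 : 0 <= a by exact: sqrtr_ge0.
have b1 : 1 <= b by rewrite -[1]sqrtr1 ler_sqrt ?ler1n.
have r1 : 1 <= r%:R :> R.
  by rewrite ler1n (leq_trans _ (ri (Ordinal m0))).
have b2 : b ^+ 2 = m%:R by rewrite sqr_sqrtr.
have a2 : a ^+ 2 = V / 2 by rewrite sqr_sqrtr// divr_ge0.
have h : Num.sqrt (S / 2) <= a + r%:R * b.
  have ab0 : 0 <= a + r%:R * b by rewrite addr_ge0// mulr_ge0// (le_trans ler01).
  rewrite -(ger0_norm ab0) -sqrtr_sqr ler_sqrt ?sqr_ge0//.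
  rewrite /S -b2 sqrrD a2 exprMn.
  have : 0 <= a * (r%:R * b) by rewrite mulr_ge0// mulr_ge0// (le_trans ler01).
  have : 0 <= b ^+ 2 * r%:R ^+ 2 by rewrite mulr_ge0 ?sqr_ge0.
  lra.
rewrite -/a -/b; nra.
Qed.
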